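(* (i) For every finitely generated infinite group $G$, the group $G\times G$ has infinite strong cop number, i.e. $\operatorname{sCop}(G\times G)=\infty$. (ii) Grigorchuk's group and, more generally, every finitely generated branch group has infinite strong cop number.
   Context: Convention: $\mathbb{N}=\mathbb{Z}_{\geq 1}$. Graphs are connected, undirected, without double edges or loops, with the path metric on vertices. Game. Let $\Gamma$ be a graph. The cops and robbers game on $\Gamma$ has parameters: number of cops $n\in\mathbb{N}$, base point (treasure) $v\in\Gamma$ a vertex, cop speed $\sigma\in\mathbb{N}$, robber speed $\psi\in\mathbb{N}$, cop reach $\rho\in\mathbb{N}$, robber radius $R\in\mathbb{N}$. It is a two-player game with perfect information. First the cop player chooses $n$ vertices as starting positions of the cops, then the robber chooses a vertex as starting position. The players then alternate turns, starting with the cops. In each turn the cop player may move each cop along a path of length at most $\sigma$ to some vertex; then the robber moves along a path of length at most $\psi$ ending in a vertex. One cop move followed by one robber move is a stage. The cop player wins if the robber is captured, i.e. at some time during some stage the robber's position is at distance at most $\rho$ from some cop's position (this includes every vertex traversed by the robber during a move: the robber must traverse the path edge by edge without ever coming within distance $\rho$ of a cop), or if the cops eventually defend $v$, i.e. after some finite initial time the robber never enters the closed ball of radius $R$ around $v$. Otherwise the robber wins. The strong cop number $\operatorname{sCop}(\Gamma)\in\mathbb{N}\cup\{\infty\}$ is the infimum (with $\inf\emptyset=\infty$) of all $n\in\mathbb{N}$ such that $\forall v\in\Gamma,\ \exists\sigma\in\mathbb{N},\ \forall\psi\in\mathbb{N},\ \exists\rho\in\mathbb{N},\ \forall R\in\mathbb{N}$: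 the cop player has a winning strategy with $n$ cops. This number is invariant under quasi-isometry, so for a finitely generated group $G$ one sets $\operatorname{sCop}(G):=\operatorname{sCop}(\operatorname{Cay}(G,S))$ for any finite generating set $S$. Branch groups (Bartholdi–Grigorchuk–Šunić): an infinite group $G$ is a branch group if there are decreasing sequences of subgroups $(L_i)_{i\geq 0}$, $(H_i)_{i\geq 0}$ and integers $(k_i)_{i\geq 0}$ with $L_0=H_0=G$, $k_0=1$, $\bigcap_i H_i=\{1\}$, such that for each $i$: (1) $H_i$ is a normal subgroup of finite index in $G$; (2) $H_i$ is an internal direct product $L_i^{(1)}\times\dots\times L_i^{(k_i)}$ of $k_i$ subgroups each isomorphic to $L_i$; (3) $m_{i+1}:=k_{i+1}/k_i$ is an integer $\geq 2$ and each factor $L_i^{(j)}$ contains the $m_{i+1}$ factors $L_{i+1}^{(l)}$, $(j-1)m_{i+1}<l\leq jm_{i+1}$, of $H_{i+1}$; (4) conjugation by elements of $G$ permutes the factors $L_i^{(1)},\dots,L_i^{(k_i)}$ transitively. Grigorchuk's group is the group of automorphisms of the infinite rooted binary tree generated by $a,b,c,d$, where $a$ swaps the two subtrees below the root and $b=(a,c)$, $c=(a,d)$, $d=(1,b)$ recursively (acting on the left and right subtree respectively). *)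

(* Defs.v *)
From HB Require Import structures.
From mathcomp Require Import all_boot.
From mathcomp Require Import boolp classical_sets functions cardinality.
From mathcomp Require Import constructive_ereal.

Set Implicit Arguments.
Unset Strict Implicit.
Unset Printing Implicit Defensive.

Local Open Scope classical_set_scope.

Record graph := Graph {
  vertex :> eqType;
  adj : rel vertex;
  adj_sym : symmetric adj;
  adj_irr : irreflexive adj;
  adj_conn : forall x y : vertex, exists2 p, path adj x p & last x p = y
}.

Section PathMetric.
Variables (X : graph) (x y : X).

Lemma path_length_ex : exists k,
  `[< exists p, [/\ path (@adj X) x p, last x p = y & size p = k] >].
Proof. by have [p xp py] := adj_conn x y; exists (size p); apply/asboolP; exists p. Qed.

Definition dist : nat := ex_minn path_length_ex.

End PathMetric.

Section Game.
Variables (X : graph) (n : nat).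

(* A strategy of the cop player prescribes the starting positions and, given
   the robber's starting vertex and the paths followed by the robber so far,
   the positions of the cops after their next move.  The previous positions of
   the cops need not be recorded: they are determined by the strategy. *)
Record cop_strategy := CopStrategy {
  cop_start : 'I_n -> X;
  cop_move : X -> seq (seq X) -> 'I_n -> X
}.

(* A play of the robber consists of a starting vertex [r] and of the paths
   [P 0], [P 1], ... followed in the successive stages; [P t] lists the vertices
   after the one where the robber stands before stage [t]. *)
Section Play.
Variables (s : cop_strategy) (r : X) (P : nat -> seq X).

(* positions before stage [t], i.e. after [t] complete stages *)
Fixpoint robber_pos t : X :=
  if t is t'.+1 then last (robber_pos t') (P t') else r.

Definition cop_pos t : 'I_n -> X :=
  if t is t'.+1 then cop_move s r (mkseq P t') else cop_start s.

Definition robber_legal psi :=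
  forall t, path (@adj X) (robber_pos t) (P t) /\ size (P t) <= psi.

(* A cop may move along a path of length at most [sigma]; only the two ends of
   that path matter for the rest of the game. *)
Definition cop_legal sigma :=
  forall t i, dist (cop_pos t i) (cop_pos t.+1 i) <= sigma.

Definition robber_visits t (x : X) : bool := x \in robber_pos t :: P t.

(* In stage [t] the robber faces the cops first at [cop_pos t], and then, from
   their move until the end of the stage, at [cop_pos t.+1]. *)
Definition captured rho := exists t i,
  dist (cop_pos t i) (robber_pos t) <= rho \/
  exists2 x, robber_visits t x & dist (cop_pos t.+1 i) x <= rho.

Definition defended v R := exists t0, forall t x,
  t0 <= t -> robber_visits t x -> R < dist v x.

End Play.

Definition cops_win v sigma psi rho R := exists s : cop_strategy,
  forall r P, robber_legal r P psi ->
    cop_legal s r P sigma /\ (captured s r P rho \/ defended r P v R).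

Definition strongly_cop_win :=
  forall v, exists2 sigma, 0 < sigma & forall psi, 0 < psi ->
  exists2 rho, 0 < rho & forall R, 0 < R -> cops_win v sigma psi rho R.

End Game.

Definition sCop (X : graph) : \bar nat :=
  if pselect (exists n, `[< 0 < n /\ strongly_cop_win X n >]) is left ex
  then (ex_minn ex)%:E else +oo%E.

Local Open Scope group_scope.

Definition subgroup (G : groupType) (H : set G) :=
  H 1 /\ forall x y, H x -> H y -> H (x / y).

Definition generated (G : groupType) (S : set G) : set G := smallest (@subgroup G) S.

Definition generates (G : groupType) (S : set G) := generated S = [set: G].

Definition finitely_generated (G : groupType) :=
  exists2 S : set G, finite_set S & generates S.

Section Cayley.
Variables (G : groupType) (S : set G).

Definition cayley_adj : rel G := fun g h =>
  (g != h) && `[< exists2 s, S s & h = g * s \/ g = h * s >].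

Lemma cayley_sym : symmetric cayley_adj.
Proof.
move=> g h; rewrite /cayley_adj eq_sym; congr (_ && _).
by apply/asboolP/asboolP => -[s Ss []]; exists s; auto.
Qed.

Lemma cayley_irr : irreflexive cayley_adj.
Proof. by move=> g; rewrite /cayley_adj eqxx. Qed.

Hypothesis genS : generates S.

Lemma cayley_conn g h : exists2 p, path cayley_adj g p & last g p = h.
Proof.
pose K x := forall g, exists2 p, path cayley_adj g p & last g p = g * x.
suff KS : [set M | subgroup M /\ S `<=` M] K.
  have : generated S (g^-1 * h) by rewrite genS.
  by move=> /(_ K KS g) [p gp pE]; exists p; rewrite ?mulVKg in pE *.
split; last first.
  move=> s Ss x; have [xxs|nxxs] := eqVneq x (x * s); first by exists [::].
  exists [:: x * s] => //=; rewrite andbT /cayley_adj nxxs /=.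
  by apply/asboolP; exists s => //; left.
split=> [x|x y Kx Ky z]; first by exists [::]; rewrite ?mulg1.
have [p zp pE] := Kx z; have [q yq] := Ky (z * x / y).
rewrite mulgVK mulgA; move: (z * x / y) yq => w wq qE.
exists (p ++ rev (belast w q)).
  rewrite cat_path zp pE -qE rev_path.
  by rewrite (eq_path (e' := cayley_adj)) // => a b; rewrite cayley_sym.
rewrite last_cat pE; case: q wq qE => [|a q] _ /= qE; first by rewrite qE.
by rewrite rev_cons last_rcons.
Qed.

Definition Cayley : graph := Graph cayley_sym cayley_irr cayley_conn.

End Cayley.

Section Branch.
Variable G : groupType.
Implicit Types A B H K : set G.

Definition normal_subgroup H := subgroup H /\ forall x g, H x -> H (x ^ g).

Definition finite_index H := finite_set (range (fun g => [set g * h | h in H])).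

Definition isomorphic A B := exists2 f : G -> G, set_bij A B f &
  forall x y, A x -> A y -> f (x * y) = f x * f y.

(* the multiplication map from the product of the [K j] to [H] is an
   isomorphism *)
Definition internal_direct_product H k (K : 'I_k -> set G) :=
  [/\ forall j, subgroup (K j),
      forall j l x y, j != l -> K j x -> K l y -> commute x y
    & set_bij [set x : 'I_k -> G | forall j, K j (x j)] H
              (fun x => \prod_(j < k) x j)].

Definition conj_set A (g : G) : set G := [set x ^ g | x in A].

(* [F i j] is the factor number [j + 1] of [H i]; it is only meaningful for
   [j < k i]. *)
Definition branch_group :=
  infinite_set [set: G] /\
  exists (L H : nat -> set G) (k : nat -> nat) (F : nat -> nat -> set G),
  [/\ L 0 = [set: G], H 0 = [set: G] & k 0 = 1%N] /\
  [/\ forall i, subgroup (L i),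
      forall i, L i.+1 `<=` L i,
      forall i, H i.+1 `<=` H i
    & \bigcap_i H i = [set 1]] /\
  forall i,
  [/\ normal_subgroup (H i) /\ finite_index (H i),
      internal_direct_product (H i) (fun j : 'I_(k i) => F i j) /\
      (forall j, (j < k i)%N -> isomorphic (F i j) (L i)),
      exists2 m, (2 <= m)%N & k i.+1 = (k i * m)%N /\
        forall j l, (j < k i)%N -> (j * m <= l < j.+1 * m)%N ->
          F i.+1 l `<=` F i j
    & (forall g j, (j < k i)%N ->
         exists2 l, (l < k i)%N & conj_set (F i j) g = F i l) /\
      (forall j l, (j < k i)%N -> (l < k i)%N ->
         exists g, conj_set (F i j) g = F i l)].

End Branch.

(* The vertices are the finite words; the root is the empty word, and the
   children of [w] are [rcons w false] (left) and [rcons w true] (right). *)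
Definition word := seq bool.

Definition tree_adj (u v : word) := exists x, v = rcons u x \/ u = rcons v x.

(* an automorphism is paired with its inverse *)
Definition tree_autP (p : (word -> word) * (word -> word)) : Prop :=
  [/\ cancel p.1 p.2, cancel p.2 p.1, p.1 [::] = [::]
    & forall u v, tree_adj (p.1 u) (p.1 v) <-> tree_adj u v].

Definition tree_aut := {p | `[< tree_autP p >]}.

HB.instance Definition _ := gen_eqMixin tree_aut.
HB.instance Definition _ := gen_choiceMixin tree_aut.

Definition TreeAut p (h : tree_autP p) : tree_aut := exist _ p (asboolT h).

Definition tree_act (f : tree_aut) : word -> word := (sval f).1.

Section TreeAutGroup.
Implicit Types f g : tree_aut.

Lemma tree_aut_spec f : tree_autP (sval f).
Proof. by case: f => p /= /asboolP. Qed.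

Lemma tree_aut_ext f g : tree_act f =1 tree_act g -> f = g.
Proof.
move=> fg; apply: val_inj => /=; have := tree_aut_spec f; have := tree_aut_spec g.
rewrite /tree_act in fg; case: (sval f) (sval g) fg => [f1 f2] [g1 g2] /=.
move=> /funext-> [/= gK Kg _ _] [/= fK Kf _ _]; congr pair.
by apply/funext => u; rewrite -{1}(Kg u) fK.
Qed.

Fact tree_one_subproof : tree_autP (id, id). Proof. by []. Qed.
Definition tree_one := TreeAut tree_one_subproof.

Fact tree_mul_subproof f g :
  tree_autP ((sval f).1 \o (sval g).1, (sval g).2 \o (sval f).2).
Proof.
have [fK Kf f0 fE] := tree_aut_spec f; have [gK Kg g0 gE] := tree_aut_spec g.
split=> /= [||| u v]; [exact: can_comp|exact: can_comp|by rewrite g0|].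
by rewrite fE gE.
Qed.
Definition tree_mul f g := TreeAut (tree_mul_subproof f g).

Fact tree_inv_subproof f : tree_autP ((sval f).2, (sval f).1).
Proof.
have [fK Kf f0 fE] := tree_aut_spec f.
by split=> //= [|u v]; [rewrite -[in LHS]f0 fK | rewrite -fE !Kf].
Qed.
Definition tree_inv f := TreeAut (tree_inv_subproof f).

Fact tree_mulA : associative tree_mul.
Proof. by move=> f g h; apply: tree_aut_ext. Qed.
Fact tree_mul1 : left_id tree_one tree_mul.
Proof. by move=> f; apply: tree_aut_ext. Qed.
Fact tree_mul1r : right_id tree_one tree_mul.
Proof. by move=> f; apply: tree_aut_ext. Qed.
Fact tree_mulV : left_inverse tree_one tree_inv tree_mul.
Proof.
by move=> f; apply: tree_aut_ext => u; have [fK _ _ _] := tree_aut_spec f; apply: fK.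
Qed.
Fact tree_mulVr : right_inverse tree_one tree_inv tree_mul.
Proof.
by move=> f; apply: tree_aut_ext => u; have [_ Kf _ _] := tree_aut_spec f; apply: Kf.
Qed.

End TreeAutGroup.

HB.instance Definition _ :=
  isGroup.Build tree_aut tree_mulA tree_mul1 tree_mul1r tree_mulV tree_mulVr.

Definition grig_a (w : word) : word := if w is x :: u then ~~ x :: u else [::].

Fixpoint grig_b (w : word) : word :=
  match w with
  | [::] => [::]
  | false :: u => false :: grig_a u
  | true :: u => true :: grig_c u
  end
with grig_c (w : word) : word :=
  match w with
  | [::] => [::]
  | false :: u => false :: grig_a u
  | true :: u => true :: grig_d u
  end
with grig_d (w : word) : word :=
  match w with
  | [::] => [::]
  | false :: u => false :: u
  | true :: u => true :: grig_b u
  end.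

Lemma grig_aK : involutive grig_a.
Proof. by case=> //= x u; rewrite negbK. Qed.

Lemma grig_bcdK u :
  [/\ grig_b (grig_b u) = u, grig_c (grig_c u) = u & grig_d (grig_d u) = u].
Proof.
by elim: u => [|[] u [bK cK dK]] //=; rewrite ?grig_aK ?bK ?cK ?dK.
Qed.

Lemma grig_a_rcons u x : exists y, grig_a (rcons u x) = rcons (grig_a u) y.
Proof. by case: u => [|z u]; [exists (~~ x) | exists x]. Qed.

Lemma grig_bcd_rcons u x :
  [/\ exists y, grig_b (rcons u x) = rcons (grig_b u) y,
      exists y, grig_c (rcons u x) = rcons (grig_c u) y
    & exists y, grig_d (rcons u x) = rcons (grig_d u) y].
Proof.
elim: u => [|[] u [[b bE] [c cE] [d dE]]] /=.
- by split; exists x; case: x.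
- by split; [exists c | exists d | exists b]; rewrite ?cE ?dE ?bE.
- have [y yE] := grig_a_rcons u x.
  by split; [exists y | exists y | exists x]; rewrite ?yE.
Qed.

Lemma involution_tree_aut (f : word -> word) : involutive f -> f [::] = [::] ->
  (forall u x, exists y, f (rcons u x) = rcons (f u) y) -> tree_autP (f, f).
Proof.
move=> fK f0 fE; have fadj u v : tree_adj u v -> tree_adj (f u) (f v).
  by case=> x [] ->; [have [y ->] := fE u x|have [y ->] := fE v x]; exists y; auto.
by split=> // u v; split=> /= /fadj; rewrite ?fK.
Qed.

Definition aut_a : tree_aut := TreeAut
  (involution_tree_aut grig_aK erefl grig_a_rcons).

Lemma grig_b_aut : tree_autP (grig_b, grig_b).
Proof.
by apply: involution_tree_aut => // u => [|x];
  [have [] := grig_bcdK u | have [] := grig_bcd_rcons u x].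
Qed.

Lemma grig_c_aut : tree_autP (grig_c, grig_c).
Proof.
by apply: involution_tree_aut => // u => [|x];
  [have [] := grig_bcdK u | have [] := grig_bcd_rcons u x].
Qed.

Lemma grig_d_aut : tree_autP (grig_d, grig_d).
Proof.
by apply: involution_tree_aut => // u => [|x];
  [have [] := grig_bcdK u | have [] := grig_bcd_rcons u x].
Qed.

Definition aut_b : tree_aut := TreeAut grig_b_aut.
Definition aut_c : tree_aut := TreeAut grig_c_aut.
Definition aut_d : tree_aut := TreeAut grig_d_aut.

Definition grigorchuk_pred : pred tree_aut :=
  fun f => `[< generated [set aut_a; aut_b; aut_c; aut_d] f >].

Lemma grigorchuk_closed : group_closed grigorchuk_pred.
Proof.
split=> [|f g /asboolP fG /asboolP gG]; apply/asboolP => K KS; first by case: KS => -[].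
by have [[_ KV] _] := KS; apply: KV; [apply: fG | apply: gG].
Qed.

Definition grigorchuk := {f | grigorchuk_pred f}.

HB.instance Definition _ := SubChoice.on grigorchuk.
HB.instance Definition _ :=
  SubChoice_isSubGroup.Build tree_aut grigorchuk_pred grigorchuk grigorchuk_closed.

(* Main.v *)
Require Import Defs.
From mathcomp Require Import all_boot zify.
From mathcomp Require Import boolp classical_sets functions cardinality.
From mathcomp Require Import constructive_ereal.

(** All the groups of the theorem have a subgroup of finite index that is a
    direct product of two infinite subgroups [A] and [B].  For the square of a
    group this is clear; for a branch group one takes the factors of the first
    level; in Grigorchuk's group [A] and [B] are the rigid stabilisers of the two
    subtrees below the root.

    In such a group, walk in [A] away from [B] at linear speed ([axis]), walk in
    [B] away from [A] in the same way, and multiply: as [A] and [B] commute, the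
    result is a grid, of any prescribed size, on which moving by one step costs
    at most [C] and on which the difference of each coordinate is at most the
    distance in the group plus [C], where [C] does not depend on the size
    ([sCop_virtual_product]).

    On a graph containing such grids the robber defeats any number [n] of cops
    ([evasion]).  Consider [n + 1] rows and [n + 1] columns of a grid, at a
    spacing [E] that is a large multiple of the reach [rho], as streets.  A cop is
    close to at most one row and at most one column, so at each time there is a
    row and a column far from all the cops.  The robber always goes from the
    crossing of a safe row and a safe column to a crossing that is safe at the
    next inspection, along a street chosen earlier and a street chosen now
    ([street_evasion]).  Only the ratio of the speeds matters: the robber has
    to cross the pattern before the cops approach by [E], and the
    speed needed depends on [n], [C] and [sigma] but not on [rho].  The finitely
    many crossings lie in a ball around the treasure, which therefore is never
    defended. *)

Set Implicit Arguments.
Unset Strict Implicit.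
Unset Printing Implicit Defensive.

Local Open Scope classical_set_scope.

(** * Paths and chains in graphs *)

Section Paths.
Variable X : graph.
Implicit Types (x y z : X) (Z : set X) (N : nat).

Lemma dist_path x p : path (@adj X) x p -> dist x (last x p) <= size p.
Proof.
move=> xp; rewrite /dist; case: ex_minnP => m _; apply.
by apply/asboolP; exists p.
Qed.

Lemma geodesic x y :
  exists p, [/\ path (@adj X) x p, last x p = y & size p = dist x y].
Proof. by rewrite /dist; case: ex_minnP => m /asboolP[p [? ? ?] _]; exists p. Qed.

Lemma distxx x : dist x x = 0.
Proof. by have := @dist_path x [::] isT; rewrite leqn0 => /eqP. Qed.

Lemma dist_triangle x y z : dist x z <= dist x y + dist y z.
Proof.
have [p [xp <- <-]] := geodesic x y; have [q [yq <- <-]] := geodesic (last x p) z.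
by rewrite -last_cat -size_cat dist_path // cat_path xp.
Qed.

(** The set [Z] also constrains the interior of the path: the robber can be
    captured while he moves, so whole routes have to be safe. *)
Definition joined N Z x y := exists p, [/\ path (@adj X) x p, last x p = y,
  size p <= N & {in x :: p, forall z, Z z}].

Lemma joined_sym N Z x y : joined N Z x y -> joined N Z y x.
Proof.
case=> p [xp <- pN pZ]; exists (rev (belast x p)); split.
- by rewrite rev_path (eq_path (e' := @adj X)) // => a b; rewrite adj_sym.
- by case: p {xp pN pZ} => //= a p; rewrite rev_cons last_rcons.
- by rewrite size_rev size_belast.
by move=> z; rewrite -rev_rcons -lastI mem_rev; apply: pZ.
Qed.

Lemma joined_trans N M Z x y z :
  joined N Z x y -> joined M Z y z -> joined (N + M) Z x z.
Proof.
case=> p [xp <- pN pZ] [q [yq <- qM qZ]]; exists (p ++ q); split.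
- by rewrite cat_path xp.
- by rewrite last_cat.
- by rewrite size_cat leq_add.
move=> w; rewrite -cat_cons mem_cat => /orP[/pZ//|wq].
by apply: qZ; rewrite inE wq orbT.
Qed.

Lemma joined_sub N M Z Z' x y : N <= M -> Z `<=` Z' ->
  joined N Z x y -> joined M Z' x y.
Proof.
move=> NM ZZ [p [xp xpy pN pZ]]; exists p; split=> //; first exact: leq_trans NM.
by move=> z /pZ /ZZ.
Qed.

Lemma dist_sym x y : dist x y = dist y x.
Proof.
suff le (a b : X) : dist a b <= dist b a by apply/eqP; rewrite eqn_leq !le.
have [p [bp pa ps]] := geodesic b a.
have [|q [aq qb qN _]] := @joined_sym (dist b a) setT b a.
  by exists p; split; rewrite ?ps.
by apply: leq_trans qN; rewrite -qb; apply: dist_path.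
Qed.

Lemma joined_geodesic N x y : dist x y <= N ->
  joined N [set z | dist x z <= N] x y.
Proof.
move=> xyN; have [p [xp px ps]] := geodesic x y.
exists p; split=> //; first by rewrite ps.
move=> z zp /=; move: ps xp; case/splitPl: p / zp px => p q <- _.
rewrite cat_path size_cat => ps /andP[xp _].
by apply: leq_trans (dist_path xp) _; lia.
Qed.

(** The interpolating vertices stay within [C] of the chain, so a chain of
    vertices at bounded distance yields a street that is not much wider. *)
Lemma joined_chain C (w : nat -> X) k l :
  (forall m, dist (w m) (w m.+1) <= C) ->
  joined (C * (maxn k l - minn k l)) [set z | exists m, dist (w m) z <= C]
    (w k) (w l).
Proof.
move=> wC; wlog kl : k l / k <= l => [W|].
  by case/orP: (leq_total k l) => kl; last (apply: joined_sym; rewrite maxnC minnC); apply: W.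
have -> : maxn k l - minn k l = l - k by lia.
rewrite -{2}(subnKC kl); elim: (l - k) => {l kl} [|d IH].
  rewrite addn0; exists [::]; split=> // z; rewrite inE => /eqP->.
  by exists k; rewrite distxx.
rewrite mulnSr addnS; apply: joined_trans IH _.
apply: joined_sub (joined_geodesic (wC _)) => // z; by exists (k + d).
Qed.

End Paths.

(** * Evading the cops on coarse grids *)

(** A play in which every move of the robber is a function [F] of the earlier
    moves exists: the moves are computed one after the other from the history. *)
Section Causal.
Variables (Y : Type) (y0 : Y) (F : (nat -> Y) -> nat -> Y).

Fixpoint history t : seq Y :=
  if t is t'.+1 then rcons (history t') (F (nth y0 (history t')) t') else [::].

Lemma causal_fixpoint :
  (forall P P' t, (forall u, u < t -> P u = P' u) -> F P t = F P' t) ->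
  exists P, forall t, P t = F P t.
Proof.
move=> causal; exists (fun t => F (nth y0 (history t)) t) => t.
apply: causal => u; have hs n : size (history n) = n.
  by elim: n => //= n IH; rewrite size_rcons IH.
elim: t => // t IH; rewrite ltnS leq_eqVlt => /orP[/eqP->|ut] /=;
  by rewrite nth_rcons hs ?ltnn ?eqxx ?ut ?IH.
Qed.

End Causal.

Lemma cop_pos_causal (X : graph) n (s : cop_strategy X n) r P P' t :
  (forall u, u < t -> P u = P' u) -> cop_pos s r P t = cop_pos s r P' t.
Proof.
case: t => //= t PP; congr cop_move; apply/eq_in_map => u.
by rewrite mem_iota => /andP[_ ut]; apply: PP; lia.
Qed.

(** Arbitrarily large square grids embedded quasi-isometrically, with a constant
    that does not depend on their size.  The maps are total on [nat * nat] but
    the lower bounds are required only up to [M]; for [k' <= k] they hold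
    trivially. *)
Definition coarse_grids (X : graph) := exists C, forall M,
  exists Q : nat -> nat -> X,
  [/\ forall k l, dist (Q k l) (Q k.+1 l) <= C,
      forall k l, dist (Q k l) (Q k l.+1) <= C,
      forall k k' l l', k' <= M -> k' <= k + C + dist (Q k l) (Q k' l')
    & forall k k' l l', l' <= M -> l' <= l + C + dist (Q k l) (Q k' l')].

Section Evasion.
Variables (X : graph) (n : nat).

(** A cop who is within [D] of two streets makes these streets
    [D.*2]-close, so [n] cops threaten at most [n] streets. *)
Lemma safe_street (I : finType) (V : I -> set X) D (c : 'I_n -> X) : n < #|I| ->
  (forall i j z w, i != j -> V i z -> V j w -> D.*2 < dist z w) ->
  exists i, forall a z, V i z -> D < dist (c a) z.
Proof.
move=> nI sep; apply: contrapT => none.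
have {none} bad i : exists a, exists2 z, V i z & dist (c a) z <= D.
  apply: contrapT => ok; apply: none; exists i => a z Vz.
  by rewrite ltnNge; apply/negP => ?; apply: ok; exists a, z.
have [f fP] := choice bad.
suff /leq_card : injective f by rewrite card_ord leqNgt nI.
move=> i j fij; apply/eqP; apply/negPn/negP => ij.
have [[z Vz zD] [w Vw wD]] := (fP i, fP j).
have := sep i j z w ij Vz Vw; have := dist_triangle z (c (f i)) w.
rewrite [dist z (c _)]dist_sym {2}fij; lia.
Qed.

Lemma cop_drift (s : cop_strategy X n) r P sigma t u z i : cop_legal s r P sigma ->
  t <= u -> dist (cop_pos s r P t i) z <= (u - t) * sigma + dist (cop_pos s r P u i) z.
Proof.
move=> leg /subnKC<-; rewrite addKn; elim: (u - t) => [|d IH]; first by rewrite addn0.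
rewrite mulSn addnS; have := leg (t + d) i.
have := dist_triangle (cop_pos s r P (t + d) i) (cop_pos s r P (t + d).+1 i) z; lia.
Qed.

(** Time is cut into epochs of [rho] stages.  At the beginning of an epoch the
    robber stands at the crossing of a street of [V] and a street of [H]; he
    looks at the cops, picks a street in each family that is far from all of
    them, and spends the epoch walking along his current street of [V] and then
    along the new street of [H].  The street of [V] was picked one epoch earlier
    and the street of [H] just now, so both were at distance more than
    [rho * (2 * sigma + 1)] from the cops at most [2 * rho] stages ago, and the
    cops have approached by at most [2 * rho * sigma] since. *)
Lemma street_evasion (I : finType) (V H : I -> set X) (x : I -> I -> X)
    sigma psi rho v R :
  0 < rho -> n < #|I| ->
  (forall i j z w, i != j -> V i z -> V j w -> (rho * sigma.*2.+1).*2 < dist z w) ->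
  (forall i j z w, i != j -> H i z -> H j w -> (rho * sigma.*2.+1).*2 < dist z w) ->
  (forall i j i' j', joined (psi * rho) (V i `|` H j') (x i j) (x i' j')) ->
  (forall i j, dist v (x i j) <= R) ->
  ~ cops_win n v sigma psi rho R.
Proof.
move=> rho0 nI sepV sepH streets nearv [s win].
have [pV pVP] := choice (fun c => safe_street c nI sepV).
have [pH pHP] := choice (fun c => safe_street c nI sepH).
pose join a b := joined (psi * rho) (V a.1 `|` H b.2) (x a.1 a.2) (x b.1 b.2).
have [route routeP] := choice (fun ab : (I * I) * (I * I) =>
  streets ab.1.1 ab.1.2 ab.2.1 ab.2.2 : join ab.1 ab.2).
pose r := x (pV (cop_start s)) (pH (cop_start s)).
pose target P e := let c := cop_pos s r P (e * rho) in (pV c, pH c).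
(* In epoch 0 the predecessor is 0 again: the robber starts at the crossing that
   he would choose there. *)
pose itinerary P e := route (target P e.-1, target P e).
(* Each stage covers the next [psi] steps of the route of the current epoch. *)
pose F P t := take psi (drop (t %% rho * psi) (itinerary P (t %/ rho))).
have [|P PE] := @causal_fixpoint _ [::] F.
  move=> P P' t PP; rewrite /F; congr (take _ (drop _ _)).
  have E e : e <= t %/ rho -> target P e = target P' e.
    move=> et; rewrite /target (@cop_pos_causal _ _ s r P P') // => u ue; apply: PP.
    apply: leq_trans ue _; apply: leq_trans (leq_mul et (leqnn _)) _.
    exact: leq_trunc_div.
  by rewrite /itinerary !E ?leq_pred.
pose corner e := x (target P e).1 (target P e).2.
have posE t : robber_pos r P t = last (corner (t %/ rho).-1)
    (take (t %% rho * psi) (itinerary P (t %/ rho))).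
  elim: t => [|t IH]; first by rewrite mod0n div0n mul0n take0.
  rewrite /= IH PE /F.
  have E := divn_eq t rho; have lt := ltn_pmod t rho0.
  set e := t %/ rho in E *; set u := t %% rho in E lt *.
  have lastE : last (corner e.-1) (take (u.+1 * psi) (itinerary P e)) =
      last (last (corner e.-1) (take (u * psi) (itinerary P e)))
         (take psi (drop (u * psi) (itinerary P e))).
    by rewrite -last_cat mulSnr takeD.
  rewrite -lastE; case: (ltngtP u.+1 rho) lt => // [lt _|lt _].
    by rewrite E -addnS divnMDl // modnMDl divn_small // modn_small // addn0.
  have -> : t.+1 = e.+1 * rho by lia.
  rewrite mulnK // modnMl mul0n take0 /= lt.
  have [_ lastR sz _] := routeP (target P e.-1, target P e).
  by rewrite take_oversize 1?mulnC //; apply/esym/lastR.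
have visit t : {subset robber_pos r P t :: P t <=
    corner (t %/ rho).-1 :: itinerary P (t %/ rho)}.
  move=> z; rewrite posE PE /F inE => /orP[/eqP->|].
    have := mem_last (corner (t %/ rho).-1)
       (take (t %% rho * psi) (itinerary P (t %/ rho))).
    by rewrite !inE => /orP[->//|/mem_take->]; rewrite orbT.
  by move=> /mem_take/mem_drop; rewrite inE orbC => ->.
have [|leg []] := win r P.
- move=> t; rewrite posE PE /F size_take_min geq_minl; split=> //.
  have [+ _ _ _] := routeP (target P (t %/ rho).-1, target P (t %/ rho)).
  rewrite -{1}(cat_take_drop (t %% rho * psi) (route _)) cat_path => /andP[_].
  by rewrite -{1}(cat_take_drop psi (drop _ _)) cat_path => /andP[].
- case=> t [i cap].
  suff safe z u : t <= u <= t.+1 -> z \in robber_pos r P t :: P t ->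
      rho < dist (cop_pos s r P u i) z.
    case: cap => [|[z]]; first by rewrite leqNgt safe ?mem_head ?leqnn //=.
    by move=> zt; rewrite leqNgt safe ?leqnn ?andbT.
  move=> tu /visit; have [_ _ _] := routeP (target P (t %/ rho).-1, target P (t %/ rho)).
  move=> /[apply] zVH.
  have E := divn_eq t rho; have lt := ltn_pmod t rho0.
  (* [e] is the epoch in which the street carrying [z] was picked. *)
  have [e eu [ue far]] : exists2 e, e * rho <= u & u <= e * rho + rho.*2 /\
      rho * sigma.*2.+1 < dist (cop_pos s r P (e * rho) i) z.
    by case: zVH => [/(pVP _ i)|/(pHP _ i)] far; eexists; try (split; last exact: far); nia.
  have := cop_drift z i leg eu.
  have : (u - e * rho) * sigma <= rho.*2 * sigma by rewrite leq_mul2r; lia.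
  nia.
case=> t0 /(_ (t0 * rho) (robber_pos r P (t0 * rho))) /(_ (leq_pmulr _ rho0)).
rewrite /robber_visits mem_head => /(_ isT).
by rewrite ltnNge posE modnMl mul0n take0 nearv.
Qed.

(** The streets are the rows and columns of a coarse grid at spacing [E], where
    [E] is at most a constant multiple of the reach [rho].  Since an epoch has [rho] stages, the
    speed needed to cross the whole pattern in one epoch is independent of [rho],
    as the order of the quantifiers in the game requires. *)
Lemma evasion : coarse_grids X -> ~ strongly_cop_win X n.
Proof.
case=> C grids win; have [v] : exists v : X, True.
  by have [Q _] := grids 0; exists (Q 0 0).
move=> _; have [sigma _ {}win] := win v.
pose psi := (C * (n * (3 * C + 4 * sigma + 3))).*2.+1.
have [rho rho0 {}win] := win psi isT.
(* [3 * C] absorbs the widths of two streets and the additive error of the grid. *)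
pose D := (rho * sigma.*2.+1).*2; pose E := (D + 3 * C).+1.
have [Q [stepk stepl farK farL]] := grids (n * E).
pose x (i j : 'I_n.+1) := Q (i * E) (j * E).
pose R := (\max_i \max_j dist v (x i j)).+1.
have between (i j : 'I_n.+1) : i != j -> i * E + E <= j * E \/ j * E + E <= i * E.
  rewrite -!mulSnr -(inj_eq val_inj) neq_ltn => /orP[] ij; [left|right]; exact: leq_mul.
have inGrid (i : 'I_n.+1) : i * E <= n * E by rewrite leq_mul2r -ltnS ltn_ord orbT.
have span (i j : 'I_n.+1) :
    C * (maxn (i * E) (j * E) - minn (i * E) (j * E)) <= C * (n * E).
  by rewrite leq_mul2l; have := inGrid i; have := inGrid j; lia.
apply: (@street_evasion 'I_n.+1
  (fun i => [set z | exists l, dist (Q (i * E) l) z <= C])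
  (fun j => [set z | exists k, dist (Q k (j * E)) z <= C])
  x sigma psi rho v R _ _ _ _ _ _ (win R isT)) => //=.
- by rewrite card_ord.
- move=> i j z w /between ij [l zl] [m wm].
  have := dist_triangle (Q (i * E) l) z (Q (j * E) m).
  have := dist_triangle z w (Q (j * E) m); rewrite [dist w _]dist_sym.
  have := farK (i * E) (j * E) l m (inGrid j).
  by have := farK (j * E) (i * E) m l (inGrid i); rewrite [dist (Q (j * E) m) _]dist_sym; lia.
- move=> i j z w /between ij [l zl] [m wm].
  have := dist_triangle (Q l (i * E)) z (Q m (j * E)).
  have := dist_triangle z w (Q m (j * E)); rewrite [dist w _]dist_sym.
  have := farL l m (i * E) (j * E) (inGrid j).
  by have := farL m l (j * E) (i * E) (inGrid i); rewrite [dist (Q m (j * E)) _]dist_sym; lia.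
- move=> i j i' j'.
  have along : joined (C * (n * E)) [set z | exists l, dist (Q (i * E) l) z <= C]
      (x i j) (x i j').
    exact: joined_sub (span j j') _ (joined_chain _ _ (stepl _)).
  have across : joined (C * (n * E)) [set z | exists k, dist (Q k (j' * E)) z <= C]
      (x i j') (x i' j').
    have := @joined_chain _ C (Q^~ (j' * E)) (i * E) (i' * E) (fun k => stepk k _).
    by apply: joined_sub; first exact: span.
  apply: (@joined_sub _ (C * (n * E) + C * (n * E))).
  + have : E <= (3 * C + 4 * sigma + 3) * rho by rewrite /E /D; nia.
    by move=> /(leq_mul (leqnn (C * n))); rewrite /psi; lia.
  + by move=> z; exact: id.
  apply: (@joined_trans _ _ _ _ _ (x i j')).
  + by apply: joined_sub along => // z; left.
  by apply: joined_sub across => // z; right.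
move=> i j; apply: leqW.
apply: leq_trans (leq_bigmax (F := fun i => \max_j dist v (x i j)) i).
exact: (leq_bigmax (F := fun j => dist v (x i j)) j).
Qed.
End Evasion.

Lemma sCop_coarse_grids (X : graph) : coarse_grids X -> sCop X = +oo%E.
Proof.
move=> grids; rewrite /sCop; case: pselect => // ex; have [n /asboolP[_ win]] := ex.
by have := evasion grids win.
Qed.

(** * Word length and commuting subgroups *)

Section Subgroup.
Local Open Scope group_scope.
Variables (G : groupType) (H : set G).
Hypothesis subH : subgroup H.

Lemma subgroup1 : H 1. Proof. by case: subH. Qed.

Lemma subgroupV x : H x -> H x^-1.
Proof. by move=> Hx; rewrite -div1g; apply: (proj2 subH); first exact: subgroup1. Qed.

Lemma subgroupM x y : H x -> H y -> H (x * y).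
Proof. by move=> Hx /subgroupV Hy; rewrite -(invgK y); apply: (proj2 subH). Qed.

End Subgroup.

Section WordLength.
Local Open Scope group_scope.
Variables (G : groupType) (S : set G).
Hypotheses (genS : generates S) (finS : finite_set S).
Implicit Types (x y z g h : G).

Local Notation d := (@dist (Cayley genS)).

Definition len g := d 1 g.

Lemma cayley_path_mull g x p :
  path (cayley_adj S) (g * x) [seq g * y | y <- p] = path (cayley_adj S) x p.
Proof.
rewrite path_map; apply: eq_path => y z /=.
rewrite /cayley_adj (can_eq (mulKg g)); congr (_ && _).
apply/asboolP/asboolP => -[s Ss yz]; exists s => //.
  by case: yz; rewrite -mulgA => /mulgI; auto.
by case: yz => ->; rewrite mulgA; auto.
Qed.

Lemma dist_mull g x y : d (g * x) (g * y) = d x y.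
Proof.
suff le h a b : d (h * a) (h * b) <= d a b.
  by apply/eqP; rewrite eqn_leq le -{1}(mulKg g x) -{1}(mulKg g y) le.
have [p [ap <- <-]] := @geodesic (Cayley genS) a b.
rewrite -(size_map (fun y => h * y)) -(last_map (fun y => h * y)).
by apply: (@dist_path (Cayley genS)); rewrite /= cayley_path_mull.
Qed.

Lemma dist_len x y : d x y = len (x^-1 * y).
Proof. by rewrite -(dist_mull x^-1) mulVg. Qed.

Lemma lenM x y : len (x * y) <= len x + len y.
Proof.
apply: leq_trans (@dist_triangle (Cayley genS) 1 x (x * y)) _.
by rewrite [d x _]dist_len mulKg.
Qed.

Lemma lenV x : len x^-1 = len x.
Proof. by rewrite /len -(dist_mull x) mulg1 mulgV dist_sym. Qed.

Lemma geodesic_sequence g : exists w : nat -> G,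
  [/\ forall k, len (w k) <= k, forall k, len ((w k)^-1 * w k.+1) <= 1
    & forall k, len ((w k)^-1 * g) <= len g - k].
Proof.
have [p [ap pg ps]] := @geodesic (Cayley genS) 1 g; rewrite -/(len g) in ps.
exists (fun k => last 1 (take k p)); split=> k; rewrite -?dist_len.
- move: ap; rewrite -{1}(cat_take_drop k p) cat_path => /andP[ap _].
  by apply: leq_trans (dist_path ap) _; rewrite size_take_min geq_minl.
- have := ap; rewrite -{1}(cat_take_drop k p) cat_path => /andP[_].
  rewrite -addn1 takeD last_cat -{1}(cat_take_drop 1 (drop k p)) cat_path => /andP[a1 _].
  by apply: leq_trans (dist_path a1) _; rewrite size_take_min geq_minl.
move: ap pg; rewrite -{1 2}(cat_take_drop k p) cat_path last_cat => /andP[_ a2] pg.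
by rewrite -{1}pg -ps -size_drop; exact: dist_path a2.
Qed.

Lemma ball_finite r : finite_set [set g | len g <= r].
Proof.
elim: r => [|r IH].
  apply: sub_finite_set (finite_set1 (1 : G)) => g /=.
  rewrite leqn0 => /eqP g0; have [p [_ pg]] := @geodesic (Cayley genS) 1 g.
  by rewrite -/(len g) g0 -pg => /size0nil->.
pose U := S `|` [set s^-1 | s in S].
have finU : finite_set U by rewrite finite_setU; split=> //; exact: finite_image.
apply: sub_finite_set (_ : _ `<=` [set g | len g <= r] `|`
   [set g * s | g in [set g | len g <= r] & s in U]) _; last first.
  by rewrite finite_setU; split=> //; exact: finite_image2.
move=> g /=; rewrite leq_eqVlt ltnS => /orP[/eqP gr|]; last by left.
right; have [p [ap pg ps]] := @geodesic (Cayley genS) 1 g.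
case/lastP: p ap pg ps => [|p s]; first by rewrite -/(len g) gr.
rewrite -/(len g) gr rcons_path last_rcons size_rcons => /andP[ap hs] sg [pr] /=.
move: hs => /=; rewrite sg => /andP[_ /asboolP[t St gt]]; exists (last 1 p).
  by rewrite -pr; exact: (@dist_path (Cayley genS)).
exists ((last 1 p)^-1 * g); last by rewrite mulVKg.
case: gt => ->; first by rewrite mulKg; left.
by right; exists t => //; rewrite invgM mulgVK.
Qed.

Lemma finite_len_bound (A : set G) : finite_set A -> exists C, forall g, A g -> len g <= C.
Proof.
move=> /finite_seqP[s ->]; exists (\max_(g <- s) len g) => g /= gs.
by apply: leq_bigmax_seq.
Qed.

Section Axis.
Variables (A B T : set G).
Hypotheses (subA : subgroup A) (subB : subgroup B).
Hypotheses (commAB : forall a b, A a -> B b -> commute a b).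
Hypotheses (trivAB : A `&` B `<=` [set 1]) (finT : finite_set T).
Hypotheses (coverT : forall g, exists t a b, [/\ T t, A a, B b & g * t = a * b]).
Hypothesis infA : infinite_set A.

(** The factor in [A] is a function of the product since [A] and [B] meet
    trivially, and balls are finite. *)
Lemma factor_len r :
  exists C, forall a b, A a -> B b -> len (a * b) <= r -> len a <= C.
Proof.
have /choice[f fP] : forall g, exists c, forall a b, A a -> B b -> g = a * b -> a = c.
  move=> g.
  have [[a [b [Aa Bb ->]]]|none] := pselect (exists a b, [/\ A a, B b & g = a * b]); last first.
    by exists 1 => a b Aa Bb gab; case: none; exists a, b.
  exists a => x y Ax By axy; apply/esym/eqP; rewrite -[a]mulg1 -(mulVKg x (a * 1)).
  suff -> : x^-1 * (a * 1) = 1 by rewrite mulg1.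
  apply: trivAB; rewrite mulg1; split.
    by apply: subgroupM => //; apply: subgroupV.
  suff -> : x^-1 * a = y / b by apply: (proj2 subB).
  by rewrite -[a](mulgK b) axy -!mulgA mulKg.
have [C CP] : exists C, forall g, (f @` [set g | len g <= r]) g -> len g <= C.
  by apply: finite_len_bound; apply: finite_image; apply: ball_finite.
by exists C => a b Aa Bb abr; apply: CP; exists (a * b) => //; rewrite -(fP _ a b).
Qed.

(** A sequence in [A] that moves away from [B] at linear speed.  Some [a] in [A]
    has distance [m >= M] from [B], since otherwise [factor_len] would bound the
    length of the elements of [A].  Let [h] be a shortest element of the coset of
    [a] modulo [B]; for [k <= m] the [k]-th vertex of a geodesic from 1 to [h] is
    at distance exactly [k] from [B].  Pushing these vertices into the product of
    [A] and [B] and projecting to [A] gives the sequence: consecutive terms stay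
    close by [factor_len], and the projection does not change the coset modulo
    [B], hence not the distance to [B]. *)
Lemma axis : exists C, forall M, exists w : nat -> G,
  [/\ forall k, A (w k), forall k, len ((w k)^-1 * w k.+1) <= C
    & forall k k' b, B b -> k' <= M -> k' <= k + C + len ((w k)^-1 * w k' * b)].
Proof.
have [c cT] := finite_len_bound finT; have [C1 C1P] := factor_len (c + 1 + c).
exists (C1 + (c + c)) => M.
have [a [Aa aM]] : exists a, A a /\ forall b, B b -> M <= len (b * a).
  apply: contrapT => none; apply: infA; have [C CP] := factor_len M.
  apply: sub_finite_set (ball_finite C) => a Aa /=; apply: contrapT => aC.
  apply: none; exists a; split=> // b Bb; rewrite leqNgt; apply/negP => /ltnW.
  by rewrite -(commAB Aa Bb) => /(CP _ _ Aa Bb).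
pose P m := `[< exists2 b, B b & len (b * a) = m >].
have exP : exists m, P m.
  by exists (len (1 * a)); apply/asboolP; exists 1 => //; exact: subgroup1 subB.
case: (ex_minnP exP) => m /asboolP[b0 Bb0 bam] mmin.
set h := b0 * a in bam; have Mm : M <= m by rewrite -bam aM.
have {mmin} hmin b : B b -> m <= len (b * h).
  move=> Bb; apply: mmin; apply/asboolP; exists (b * b0); first exact: subgroupM.
  by rewrite mulgA.
clearbody h; have [g [gk gstep gh]] := geodesic_sequence h; rewrite bam in gh.
have far k b : B b -> k <= m -> k <= len (b * g k).
  move=> Bb km; have := hmin b Bb; have := gh k.
  suff : len (b * h) <= len (b * g k) + len ((g k)^-1 * h) by lia.
  by apply: leq_trans (lenM _ _); rewrite mulgA mulgK.
have /choice[f fP] : forall k, exists x : G * G,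
    [/\ A x.1, B x.2 & len ((g k)^-1 * (x.1 * x.2)) <= c].
  move=> k; have [t [x [y [Tt Ax By gxy]]]] := coverT (g k).
  by exists (x, y); split=> //=; rewrite -gxy mulKg cT.
pose w k := (f k).1; pose v k := (f k).2.
have Aw k : A (w k) by case: (fP k).
have Bv k : B (v k) by case: (fP k).
have near k : len ((g k)^-1 * (w k * v k)) <= c by case: (fP k).
have near' k : len ((w k * v k)^-1 * g k) <= c.
  by rewrite -lenV invgM invgK near.
exists w; split=> // [k|k k' b Bb k'M].
  suff : len ((w k)^-1 * w k.+1) <= C1 by lia.
  have [AV BV] := (subgroupV subA (Aw k), subgroupV subB (Bv k)).
  apply: (C1P _ ((v k)^-1 * v k.+1)); [exact: subgroupM|exact: subgroupM|].
  have -> : (w k)^-1 * w k.+1 * ((v k)^-1 * v k.+1) =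
      (w k * v k)^-1 * g k * ((g k)^-1 * g k.+1) * ((g k.+1)^-1 * (w k.+1 * v k.+1)).
    rewrite invgM -!mulgA !mulVKg.
    by rewrite (mulgA (w k.+1)) (commAB (Aw _) BV) !mulgA (commAB AV BV).
  apply: leq_trans (lenM _ _) _; apply: leq_add => //.
  by apply: leq_trans (lenM _ _) _; apply: leq_add.
have Bb' : B (v k * b * (v k')^-1).
  by apply: subgroupM; [|exact: subgroupM|exact: subgroupV].
have := far k' _ Bb' (leq_trans k'M Mm).
have -> : v k * b * (v k')^-1 * g k' =
    g k * ((g k)^-1 * (w k * v k)) * ((w k)^-1 * w k' * b) * ((w k' * v k')^-1 * g k').
  rewrite (commAB (Aw k) (Bv k)) (commAB (Aw k') (Bv k')) invgM -!mulgA !mulVKg.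
  by rewrite (mulgA (w k')) (commAB (Aw k') Bb) -!mulgA mulVKg.
move=> /leq_trans/(_ (lenM _ _)).
have := lenM (g k * ((g k)^-1 * (w k * v k))) ((w k)^-1 * w k' * b).
have := lenM (g k) ((g k)^-1 * (w k * v k)).
have := near k; have := near' k'; have := gk k; lia.
Qed.
End Axis.

End WordLength.

(** * Virtual direct products *)

Section VirtualProduct.
Local Open Scope group_scope.

(** In other words, the internal direct product of [A] and [B] is a subgroup of
    finite index of [G]; in this form, a given element is corrected by
    one of finitely many factors, hence moved by a bounded distance. *)
Definition virtual_product (G : groupType) (A B : set G) :=
  [/\ subgroup A /\ subgroup B,
      forall a b, A a -> B b -> commute a b,
      A `&` B `<=` [set 1]
    & exists2 T : set G, finite_set T &
        forall g, exists t a b, [/\ T t, A a, B b & g * t = a * b]].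

(** The products of the terms of an axis in [A] and an axis in [B] form coarse
    grids: the distance to the cosets of [B] sees the first coordinate, and the
    distance to the cosets of [A] the second one. *)
Lemma sCop_virtual_product (G : groupType) (A B S : set G) (genS : generates S) :
  finite_set S -> virtual_product A B -> infinite_set A -> infinite_set B ->
  sCop (Cayley genS) = +oo%E.
Proof.
move=> finS [[subA subB] comm triv [T finT cover]] infA infB.
have commC b a : B b -> A a -> commute b a by move=> Bb Aa; apply/commute_sym/comm.
have [C1 axisA] := axis genS finS subA subB comm triv finT cover infA.
have [C2 axisB] : exists C, forall M, exists w : nat -> G,
  [/\ forall k, B (w k), forall k, len genS ((w k)^-1 * w k.+1) <= C
    & forall k k' b, A b -> k' <= M -> k' <= k + C + len genS ((w k)^-1 * w k' * b)].
  apply: (axis genS finS subB subA commC _ finT _ infB); first by rewrite setIC.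
  move=> g; have [t [a [b [Tt Aa Bb gt]]]] := cover g.
  by exists t, b, a; split=> //; rewrite gt; apply: comm.
apply: sCop_coarse_grids; exists (C1 + C2) => M.
have [w [Aw wstep wfar]] := axisA M; have [v [Bv vstep vfar]] := axisB M.
pose Q k l : Cayley genS := w k * v l.
have distQ k k' l l' : dist (Q k l) (Q k' l') =
    len genS ((w k)^-1 * w k' * ((v l)^-1 * v l')).
  have BV := subgroupV subB (Bv l).
  rewrite dist_len invgM -!mulgA (mulgA (w k')) (comm _ _ (Aw k') BV).
  by rewrite -!mulgA (mulgA (v l)^-1) (commC _ _ BV (subgroupV subA (Aw k))) -!mulgA.
exists Q; split=> [k l|k l|k k' l l' k'M|k k' l l' l'M]; rewrite distQ.
- by rewrite mulVg mulg1; apply: leq_trans (wstep k) (leq_addr _ _).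
- by rewrite mulVg mul1g; apply: leq_trans (vstep l) (leq_addl _ _).
- have BV : B ((v l)^-1 * v l') by apply: subgroupM => //; apply: subgroupV.
  by apply: leq_trans (wfar k k' _ BV k'M) _; rewrite leq_add2r leq_add2l leq_addr.
have AV : A ((w k)^-1 * w k') by apply: subgroupM => //; apply: subgroupV.
have BV : B ((v l)^-1 * v l') by apply: subgroupM => //; apply: subgroupV.
rewrite (comm _ _ AV BV).
by apply: leq_trans (vfar l l' _ AV l'M) _; rewrite leq_add2r leq_add2l leq_addl.
Qed.

End VirtualProduct.

Section DirectSquare.
Local Open Scope group_scope.
Variable G : groupType.

Lemma sCop_square (S : set (G * G)%type) (genS : generates S) :
  finite_set S -> infinite_set [set: G] -> sCop (Cayley genS) = +oo%E.
Proof.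
move=> finS infG.
pose A : set (G * G)%type := [set g | g.2 = 1]; pose B : set (G * G)%type := [set g | g.1 = 1].
apply: (@sCop_virtual_product _ A B) => //; last 2 first.
- apply: contra_not infG => finA.
  apply: sub_finite_set (finite_image fst finA) => g _.
  by exists (g, 1).
- apply: contra_not infG => finB.
  apply: sub_finite_set (finite_image snd finB) => g _.
  by exists (1, g).
split.
- by split; split=> // x y; rewrite /A /B /= => -> ->; rewrite mulgV.
- move=> [a1 a2] [b1 b2]; rewrite /A /B /= => -> ->.
  by apply: injective_projections => /=; rewrite ?mulg1 ?mul1g.
- by move=> [a b] []; rewrite /A /B /= => -> ->.
exists [set 1]; first exact: finite_set1.
move=> [a b]; exists 1, (a, 1), (1, b); split=> //.
by rewrite mulg1; apply: injective_projections => /=; rewrite ?mulg1 ?mul1g.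
Qed.
End DirectSquare.

(** * Branch groups *)
Section Branch.
Local Open Scope group_scope.
Variable G : groupType.

Lemma finite_index_cover (H : set G) : subgroup H -> finite_index H ->
  exists2 T : set G, finite_set T & forall g, exists2 t, T t & H (g * t).
Proof.
move=> subH finH; pose coset g : set G := [set g * h | h in H].
have /choice[rep repP] : forall D, exists g, range coset D -> coset g = D.
  move=> D; have [[g _ gD]|] := pselect (range coset D); first by exists g.
  by exists 1.
exists (rep @` range coset); first exact: finite_image.
(* Left cosets are counted, while [t] multiplies on the right: it has to be taken
   in the coset of the inverse of [g]. *)
move=> g; exists (rep (coset g^-1)); first by exists (coset g^-1) => //; exists g^-1.
have : coset g^-1 (rep (coset g^-1)).
  rewrite -{1}(repP (coset g^-1)); last by exists g^-1.
  by exists 1; [exact: subgroup1 | rewrite mulg1].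
by case=> h Hh <-; rewrite mulVKg.
Qed.

Lemma infinite_finite_index (H : set G) : subgroup H -> finite_index H ->
  infinite_set [set: G] -> infinite_set H.
Proof.
move=> subH /(finite_index_cover subH)[T finT cover]; apply: contra_not => finH.
apply: sub_finite_set (finite_image2 (fun h t => h * t^-1) finH finT) => g _.
by have [t Tt Hgt] := cover g; exists (g * t) => //; exists t => //; rewrite mulgK.
Qed.

Lemma prod_finite (F : nat -> set G) k : (forall j, j < k -> finite_set (F j)) ->
  finite_set [set \prod_(j < k) x j | x in [set x : nat -> G | forall j, j < k -> F j (x j)]].
Proof.
elim: k => [|k IH] finF.
  apply: sub_finite_set (finite_set1 (1 : G)) => _ [x _ <-].
  by rewrite big_ord0.
apply: sub_finite_set (finite_image2 (fun g h => g * h) (IH _) (finF k _)) => //; last first.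
  by move=> j jk; apply: finF; apply: leqW.
move=> _ [x Fx <-]; rewrite big_ord_recr /=; exists (\prod_(j < k) x j).
  by exists x => // j jk; apply: Fx; apply: leqW.
by exists (x k) => //; apply: Fx.
Qed.

Section DirectProduct.
Variables (H : set G) (k : nat) (K : 'I_k.+1 -> set G).
Hypothesis prodK : internal_direct_product H K.

Let tuples := [set x : 'I_k.+1 -> G | forall j, K j (x j)].
(** Encoded as the products of the tuples with trivial first entry, so that the
    uniqueness of decompositions in [H] applies directly to its elements. *)
Definition cofactor0 : set G :=
  [set \prod_(j < k.+1) x j | x in tuples `&` [set x | x ord0 = 1]].

Lemma tuple_prodM x y : tuples x -> tuples y ->
  \prod_(j < k.+1) (x j * y j) = \prod_(j < k.+1) x j * \prod_(j < k.+1) y j.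
Proof.
move=> Kx Ky; have [_ comm _] := prodK.
elim: (index_enum _) (index_enum_uniq 'I_k.+1) => [|i r IH]; first by rewrite !big_nil mulg1.
move=> /= /andP[ir /IH{}IH]; rewrite !big_cons IH -!mulgA; congr (_ * _).
rewrite !mulgA; congr (_ * _); rewrite big_seq; apply: commute_prod => j jr.
by apply: (comm i j) => //; apply: contraNneq ir => ->.
Qed.

Lemma cofactor0_subgroup : subgroup cofactor0.
Proof.
have [subK _ _] := prodK; split.
  exists (fun=> 1); last by rewrite big1.
  by split=> //= j; apply: subgroup1.
move=> _ _ [x [Kx x0] <-] [y [Ky y0] <-]; exists (fun j => x j / y j).
  by split=> [j|] /=; [apply: (proj2 (subK j))|rewrite x0 y0 mulgV].
apply/eqP; rewrite eq_sym divg_eq -tuple_prodM //; last by move=> j; apply: (proj2 (subK j)).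
by apply/eqP/eq_bigr => j _; rewrite mulgVK.
Qed.

Lemma direct_product_split :
  [/\ forall a b, K ord0 a -> cofactor0 b -> commute a b,
      K ord0 `&` cofactor0 `<=` [set 1],
      forall h, H h -> exists a b, [/\ K ord0 a, cofactor0 b & h = a * b]
    & forall j, j != ord0 -> K j `<=` cofactor0].
Proof.
have [subK comm [_ inj surj]] := prodK.
have prod0 (x : 'I_k.+1 -> G) :
    x ord0 * \prod_(j < k.+1) (if j == ord0 then 1 else x j) = \prod_(j < k.+1) x j.
  by rewrite !big_ord_recl /= mul1g.
have prod1 j (g : G) : \prod_(i < k.+1) (if i == j then g else 1) = g.
  by rewrite -big_mkcond big_pred1_eq.
split.
- move=> a _ Ka [x [Kx x0] <-]; apply: commute_prod => j _.
  have [->|j0] := eqVneq j ord0; first by rewrite x0; apply: commute1.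
  by apply: comm Ka (Kx j); rewrite eq_sym.
- move=> a [Ka [x [Kx x0] xa]]; rewrite /= -x0.
  have -> : x = fun j => if j == ord0 then a else 1; last by [].
  apply: inj; rewrite ?inE //; last by rewrite prod1.
  move=> j /=; case: eqP => [->//|_]; exact: subgroup1.
- move=> h /surj[x Kx <-]; exists (x ord0), (\prod_j (if j == ord0 then 1 else x j)).
  split=> //; exists (fun j => if j == ord0 then 1 else x j) => //.
  split=> [j|] //=.
  by case: eqP => _; [apply: subgroup1|apply: Kx].
move=> j j0 g Kg; exists (fun i => if i == j then g else 1) => //.
split=> [i|] /=; last by rewrite eq_sym (negPf j0).
by case: eqP => [->//|_]; exact: subgroup1.
Qed.

End DirectProduct.

(** The first level is enough: [H_1] has finite index and is a direct product of
    at least two isomorphic factors.  They are infinite because [H_1] is, so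
    the first factor and the product of the others can serve as [A] and [B]. *)
Lemma branch_virtual_product : branch_group G ->
  exists A B : set G, [/\ virtual_product A B, infinite_set A & infinite_set B].
Proof.
case=> infG [L [H [k [F [[L0 H0 k0] [_ levels]]]]]].
have [_ _ [m m2 [k1 _]] _] := levels 0.
have [[[subH _] finH] [prodF isoF] _ _] := levels 1%N.
have infH := infinite_finite_index subH finH infG.
rewrite {}k1 k0 mul1n in prodF isoF; case: m m2 prodF isoF => [|[|m]] // _ prodF isoF.
have infL : infinite_set (L 1%N).
  move=> finL; apply: infH; have [_ _ [_ _ surj]] := prodF.
  have finF j : j < m.+2 -> finite_set (F 1%N j).
    move=> /isoF[f [maps inj _] _]; rewrite -(eq_finite_set (inj_card_eq inj)).
    by apply: sub_finite_set finL => _ [g Fg <-]; apply: maps.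
  apply: sub_finite_set (prod_finite finF) => h /surj[x Fx <-].
  exists (fun j => x (inord j)); last by apply: eq_bigr => j _; rewrite inord_val.
  by move=> j jm /=; have := Fx (inord j); rewrite inordK.
have infF j : j < m.+2 -> infinite_set (F 1%N j).
  move=> /isoF[f [_ _ surj] _]; apply: contra_not infL => finF.
  exact: sub_finite_set surj (finite_image f finF).
have [subF _ _] := prodF; have [comm triv cover others] := direct_product_split prodF.
have [T finT coverT] := finite_index_cover subH finH.
exists (F 1%N 0), (cofactor0 (fun j : 'I_m.+2 => F 1%N j)); split.
- split=> //; first by split; [exact: (subF ord0)|exact: cofactor0_subgroup prodF].
  exists T => // g; have [t Tt /cover[a [b [Aa Bb gt]]]] := coverT g.
  by exists t, a, b.
- exact: infF.
move=> finB; apply: (infF 1%N) => //; apply: sub_finite_set finB.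
exact: (others (lift ord0 ord0)).
Qed.
End Branch.

(** * Grigorchuk's group *)

Section Grigorchuk.
Local Open Scope group_scope.
Implicit Types f g h x y : tree_aut.

Definition pair_act (p q : word -> word) (w : word) : word :=
  if w is z :: u then z :: (if z then q u else p u) else [::].

Lemma tree_adj_cons z z' u v :
  tree_adj (z :: u) (z' :: v) <-> z = z' /\ tree_adj u v.
Proof.
split=> [[t [] /= []]|[-> [t [] ->]]].
- by move=> -> ->; split=> //; exists t; left.
- by move=> -> ->; split=> //; exists t; right.
- by exists t; left.
by exists t; right.
Qed.

Lemma tree_adj_nil_cons z v : tree_adj [::] (z :: v) <-> v = [::].
Proof. by split=> [[t [[_ ->]|]]|->] //; exists z; left. Qed.

Lemma tree_adj_sym u v : tree_adj u v <-> tree_adj v u.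
Proof. by split=> -[t []->]; exists t; auto. Qed.

Lemma pair_act_aut f g : tree_autP
  (pair_act (sval f).1 (sval g).1, pair_act (sval f).2 (sval g).2).
Proof.
have [fK Kf f0 fE] := tree_aut_spec f; have [gK Kg g0 gE] := tree_aut_spec g.
split=> //= [[|[] u]|[|[] u]|] //=; rewrite ?fK ?gK ?Kf ?Kg //.
have nilE z u : tree_adj [::] (pair_act (sval f).1 (sval g).1 (z :: u)) <->
    tree_adj [::] (z :: u).
  rewrite !tree_adj_nil_cons; case: z; split=> [|->//] E.
    by rewrite -(gK u) E -g0 gK.
  by rewrite -(fK u) E -f0 fK.
move=> [|z u] [|z' v]; first by [].
- exact: nilE.
- by rewrite tree_adj_sym nilE tree_adj_sym.
by rewrite !tree_adj_cons; split=> -[<-]; case: z; rewrite ?fE ?gE.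
Qed.

(** The automorphism written [(f, g)] in the recursive definition of the
    generators. *)
Definition node f g := TreeAut (pair_act_aut f g).

Lemma nodeM f g f' g' : node f g * node f' g' = node (f * f') (g * g').
Proof. by apply: tree_aut_ext => -[|[] u]. Qed.

Lemma node1 : node 1 1 = 1.
Proof. by apply: tree_aut_ext => -[|[] u]. Qed.

Lemma nodeV f g : (node f g)^-1 = node f^-1 g^-1.
Proof. by apply/mulg1_eq; rewrite nodeM !mulgV node1. Qed.

Lemma node_inj f g f' g' : node f g = node f' g' -> f = f' /\ g = g'.
Proof.
move=> E; split; apply: tree_aut_ext => u.
  by have [] := congr1 (fun h => tree_act h (false :: u)) E.
by have [] := congr1 (fun h => tree_act h (true :: u)) E.
Qed.

Local Notation a := aut_a.
Local Notation b := aut_b.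
Local Notation c := aut_c.
Local Notation d := aut_d.

Lemma mul_aa : a * a = 1.
Proof. by apply: tree_aut_ext; exact: grig_aK. Qed.

Lemma swap_node f g : a * node f g = node g f * a.
Proof. by apply: tree_aut_ext => -[|[] u]. Qed.

Lemma aut_bE : b = node a c. Proof. by apply: tree_aut_ext => -[|[] u]. Qed.
Lemma aut_cE : c = node a d. Proof. by apply: tree_aut_ext => -[|[] u]. Qed.
Lemma aut_dE : d = node 1 b. Proof. by apply: tree_aut_ext => -[|[] u]. Qed.

Lemma mul_bb : b * b = 1.
Proof. by apply: tree_aut_ext => u; have [] := grig_bcdK u. Qed.
Lemma mul_cc : c * c = 1.
Proof. by apply: tree_aut_ext => u; have [] := grig_bcdK u. Qed.
Lemma mul_dd : d * d = 1.
Proof. by apply: tree_aut_ext => u; have [] := grig_bcdK u. Qed.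

Lemma mul_bd : b * d = c.
Proof.
suff H u : [/\ grig_b (grig_d u) = grig_c u, grig_c (grig_b u) = grig_d u
             & grig_d (grig_c u) = grig_b u].
  by apply: tree_aut_ext => u; have [] := H u.
by elim: u => [|[] u [bd cb dc]] //=; rewrite ?bd ?cb ?dc ?grig_aK.
Qed.

Local Notation Grig := (generated [set a; b; c; d]).

Lemma generated_ind (K : set tree_aut) : subgroup K ->
  K a -> K b -> K c -> K d -> Grig `<=` K.
Proof.
move=> subK Ka Kb Kc Kd f; apply; split=> // y.
by case=> [[[->|->]|->]|->].
Qed.

Lemma subGrig : subgroup Grig.
Proof.
split=> [|f g fG gG] K KS; first by case: KS => -[].
by have [[_ KV] _] := KS; apply: KV; [apply: fG | apply: gG].
Qed.

Lemma gen_in f : [set a; b; c; d] f -> Grig f.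
Proof. by move=> Sf K [_]; apply. Qed.

Lemma Gra : Grig a. Proof. by apply: gen_in; left; left; left. Qed.
Lemma Grb : Grig b. Proof. by apply: gen_in; left; left; right. Qed.
Lemma Grc : Grig c. Proof. by apply: gen_in; left; right. Qed.
Lemma Grd : Grig d. Proof. by apply: gen_in; right. Qed.

Lemma expg_ad4 : (a * d) ^+ 4 = 1.
Proof.
have ad2 : (a * d) ^+ 2 = node b b.
  rewrite expg2 {1}aut_dE swap_node -mulgA [a * (_ * _)]mulgA mul_aa mul1g.
  by rewrite aut_dE nodeM mul1g mulg1.
by rewrite (expgnDr _ 2 2) ad2 nodeM mul_bb node1.
Qed.

Lemma node_sections : Grig `<=`
  [set f | exists g h (e : bool), [/\ Grig g, Grig h & f = node g h * a ^+ e]].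
Proof.
apply: generated_ind.
- split=> [|_ _ [g [h [e [Gg Gh ->]]]] [g' [h' [e' [Gg' Gh' ->]]]]].
    by exists 1, 1, false; split; rewrite ?node1 ?mulg1 //; apply: subgroup1 subGrig.
  have Ggg := proj2 subGrig _ _ Gg Gg'; have Ghh := proj2 subGrig _ _ Gh Gh'.
  have Ggh := proj2 subGrig _ _ Gg Gh'; have Ghg := proj2 subGrig _ _ Gh Gg'.
  have aV : a^-1 = a by apply/mulg1_eq/mul_aa.
  case: e e' => [] [] /=; rewrite ?expgb ?invgM nodeV ?invg1 ?aV ?mulg1 ?mul1g.
  + by exists (g / g'), (h / h'), false; split=> //; rewrite -mulgA (mulgA a) mul_aa mul1g nodeM mulg1.
  + exists (g / h'), (h / g'), true; split=> //.
    by rewrite -mulgA swap_node mulgA nodeM.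
  + exists (g / h'), (h / g'), true; split=> //.
    by rewrite swap_node mulgA nodeM.
  by exists (g / g'), (h / h'), false; split=> //; rewrite nodeM mulg1.
- exists 1, 1, true; split; [exact: subgroup1 subGrig|exact: subgroup1 subGrig|].
  by rewrite node1 mul1g.
- by exists a, c, false; split; [exact: Gra|exact: Grc|rewrite mulg1 aut_bE].
- by exists a, d, false; split; [exact: Gra|exact: Grd|rewrite mulg1 aut_cE].
exists 1, b, false; split; [exact: subgroup1 subGrig|exact: Grb|by rewrite mulg1 aut_dE].
Qed.

(** The level stabiliser projects onto the whole group: self-similarity
    realises each generator as a second section. *)
Lemma section_lift : Grig `<=` [set f | exists g, Grig (node g f)].
Proof.
apply: generated_ind.
- split=> [|f f' [g Gg] [g' Gg']]; first by exists 1; rewrite node1; exact: subgroup1 subGrig.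
  by exists (g / g'); rewrite -nodeM -nodeV; apply: (proj2 subGrig).
- exists c; have -> : node c a = a * b * a^-1 by rewrite aut_bE swap_node mulgK.
  by exact: (proj2 subGrig _ _ (subgroupM subGrig Gra Grb) Gra).
- by exists 1; rewrite -aut_dE; exact: Grd.
- by exists a; rewrite -aut_bE; exact: Grb.
by exists a; rewrite -aut_cE; exact: Grc.
Qed.

(** A map from the group to itself sending [f] to some [(g, f)] is injective but
    misses [a], so its iterates on [a] are pairwise distinct. *)
Lemma infinite_Grig : infinite_set Grig.
Proof.
have /choice[s sP] : forall f, exists g, Grig f -> Grig (node g f).
  by move=> f; have [/section_lift[g]|] := pselect (Grig f); [exists g|exists 1].
pose e k := iter k (fun f => node (s f) f) a.
have Ge k : Grig (e k) by elim: k => [|k IH]; [exact: Gra|exact: sP].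
have a_neq_node f g : a <> node f g.
  by move=> /(congr1 (fun h => tree_act h [:: true])).
have einj : injective e.
  elim=> [|k IH] [|l] //= => [/a_neq_node//|/esym/a_neq_node//|/node_inj[_ /IH->]//].
move=> finG; apply: infinite_nat.
rewrite (_ : [set: nat] = e @^-1` Grig); first by apply: finite_preimage finG => x y _ _ /einj.
by apply/seteqP; split=> k _ //; exact: Ge.
Qed.

(** The rigid stabiliser of the right subtree, seen as a subgroup of Grigorchuk's
    group acting on that subtree. *)
Definition rist f := Grig f /\ Grig (node 1 f).

Lemma rist_subgroup : subgroup rist.
Proof.
split=> [|f g [Gf Gf1] [Gg Gg1]]; first by split; rewrite ?node1; exact: subgroup1 subGrig.
split; first exact: (proj2 subGrig).
by rewrite -(mulgV 1) -nodeM -nodeV; apply: (proj2 subGrig).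
Qed.

(** Conjugating [(1, f)] by a lift [(h, g)] of [g] changes only its second
    section. *)
Lemma rist_conj f g : rist f -> Grig g -> rist (g * f * g^-1).
Proof.
move=> [Gf Gf1] Gg; have [h Gh] := section_lift Gg; split.
  by exact: (proj2 subGrig _ _ (subgroupM subGrig Gg Gf) Gg).
have -> : node 1 (g * f * g^-1) = node h g * node 1 f * (node h g)^-1.
  by rewrite nodeV !nodeM mulg1 mulgV.
by exact: (proj2 subGrig _ _ (subgroupM subGrig Gh Gf1) Gh).
Qed.

(** Conjugation by [a] exchanges the two subtrees. *)
Lemma rist_left f : rist f -> Grig (node f 1).
Proof.
move=> [_ Gf]; have -> : node f 1 = a * node 1 f * a^-1 by rewrite swap_node mulgK.
by exact: (proj2 subGrig _ _ (subgroupM subGrig Gra Gf) Gra).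
Qed.

Definition dihedral : set tree_aut :=
  [set (a * d) ^+ i * a ^+ e | i in `I_4 & e in [set: bool]].

Lemma dihedral_finite : finite_set dihedral.
Proof. by apply: finite_image2; [exact: finite_II|exact: finite_finset]. Qed.

Lemma dihedralP i (e : bool) : dihedral ((a * d) ^+ i * a ^+ e).
Proof.
exists (i %% 4); first by rewrite /= ltn_pmod.
exists e => //; rewrite {2}(divn_eq i 4) mulnC expgnDr expgnA expg_ad4.
by rewrite expg1n mul1g.
Qed.

Lemma dihedral_Grig w : dihedral w -> Grig w.
Proof.
case=> i _ [e _ <-]; apply: (subgroupM subGrig); last first.
  by case: e; [exact: Gra|exact: subgroup1 subGrig].
elim: i => [|i IH]; first exact: subgroup1 subGrig.
rewrite expgS; apply: (subgroupM subGrig _ IH).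
exact: (subgroupM subGrig Gra Grd).
Qed.

(** [rist] is normal and contains [b], as [d = (1, b)].  Modulo [b] the generators
    [c = b * d] and [d] agree, so the quotient is generated by the involutions
    [a] and [d], whose product has order dividing 4. *)
Lemma rist_dihedral f : Grig f -> exists n w, [/\ rist n, dihedral w & f = n * w].
Proof.
pose M f := exists n w, [/\ rist n, dihedral w & f = n * w].
pose K y := forall x, M x -> M (x * y) /\ M (x / y).
suff KG : Grig `<=` K.
  have M1 : M 1.
    exists 1, 1; split; [exact: subgroup1 rist_subgroup| |by rewrite mulg1].
    by have := dihedralP 0 false; rewrite !mulg1.
  by move=> /KG /(_ 1 M1)[]; rewrite mul1g.
have involK y : y * y = 1 -> (forall x, M x -> M (x * y)) -> K y.
  by move=> yy My x Mx; rewrite (mulg1_eq yy); split; apply: My.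
have Ma x : M x -> M (x * a).
  case=> n [_ [Nn [i _ [e _ <-]] ->]]; exists n, ((a * d) ^+ i * a ^+ (~~ e)).
  split=> //; first exact: dihedralP.
  by rewrite -!mulgA; case: e => /=; rewrite ?mul1g ?mul_aa ?mulg1.
have Md x : M x -> M (x * d).
  case=> n [_ [Nn [i _ [[] _ <-]] ->]].
    exists n, ((a * d) ^+ i.+1 * a ^+ false); split=> //; first exact: dihedralP.
    by rewrite /= mulg1 [_ ^+ i.+1]expgSr expg1 -!mulgA.
  exists n, ((a * d) ^+ (i + 3) * a ^+ true); split=> //; first exact: dihedralP.
  rewrite expgnDr -!mulgA mul1g; do 2!congr (_ * _).
  by apply: (@mulIg _ d); rewrite mul_dd -expg_ad4 expgSr -!mulgA.
have Mb x : M x -> M (x * b).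
  case=> n [w [Nn Ww ->]]; exists (n * (w * b * w^-1)), w; split=> //.
    apply: (subgroupM rist_subgroup Nn); apply: rist_conj (dihedral_Grig Ww).
    by split; rewrite -?aut_dE; [exact: Grb|exact: Grd].
  by rewrite -!mulgA mulVg mulg1.
apply: generated_ind.
- split=> [x Mx|y z Ky Kz x Mx]; first by rewrite invg1 mulg1.
  rewrite invgF !mulgA; have [[Mxy _] [Mxz _]] := (Ky x Mx, Kz x Mx).
  by split; [exact: (Kz _ Mxy).2|exact: (Ky _ Mxz).2].
- exact: involK mul_aa Ma.
- exact: involK mul_bb Mb.
- by apply: involK mul_cc _ => x /Mb/Md; rewrite -mulgA mul_bd.
exact: involK mul_dd Md.
Qed.

Lemma rist_infinite : infinite_set rist.
Proof.
move=> finN; apply: infinite_Grig.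
apply: sub_finite_set (finite_image2 (fun n w => n * w) finN dihedral_finite).
by move=> f /rist_dihedral[n [w [Nn Ww ->]]]; exists n => //; exists w.
Qed.

(** [A] and [B] are the rigid stabilisers of the two subtrees.  Writing the
    sections of an element as products of an element of [rist] and one of the
    finitely many elements of [dihedral] shows that their product has finite
    index. *)
Lemma grigorchuk_virtual_product : exists A B : set grigorchuk,
  [/\ virtual_product A B, infinite_set A & infinite_set B].
Proof.
pose A : set grigorchuk := [set x | exists f, val x = node f 1].
pose B : set grigorchuk := [set x | exists f, val x = node 1 f].
have GrP (x : grigorchuk) : Grig (val x) by apply/asboolP/(valP x).
have finite_val (U : set tree_aut) : finite_set U -> finite_set [set x : grigorchuk | U (val x)].
  by apply: finite_preimage => x y _ _; exact: val_inj.
have valM (x y : grigorchuk) : val (x * y) = val x * val y by [].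
exists A, B; split; last 2 first.
- move=> /(finite_image val) finA; apply: rist_infinite.
  have : finite_set (node^~ 1 @^-1` (val @` A)).
    by apply: finite_preimage finA => x y _ _ /node_inj[].
  apply: sub_finite_set => f /rist_left/asboolT Gf.
  by exists (Sub (node f 1) Gf) => //; exists f.
- move=> /(finite_image val) finB; apply: rist_infinite.
  have : finite_set (node 1 @^-1` (val @` B)).
    by apply: finite_preimage finB => x y _ _ /node_inj[].
  apply: sub_finite_set => f [_ /asboolT Gf].
  by exists (Sub (node 1 f) Gf) => //; exists f.
split.
- split; split=> [|x y [f xf] [g yg]].
  + by exists 1; rewrite node1.
  + exists (f / g); have -> : node (f / g) 1 = node f 1 / node g 1 by rewrite nodeV nodeM mulgV.
    by rewrite -xf -yg.
  + by exists 1; rewrite node1.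
  exists (f / g); have -> : node 1 (f / g) = node 1 f / node 1 g by rewrite nodeV nodeM mulgV.
  by rewrite -xf -yg.
- move=> x y [f xf] [g yg]; apply: val_inj.
  by rewrite !valM xf yg !nodeM !mulg1 !mul1g.
- move=> x [[f xf] [g xg]]; apply: val_inj; rewrite /= xf.
  by move: xf; rewrite xg => /node_inj[<- _]; rewrite node1.
pose T := [set t : grigorchuk | [set a ^+ nat_of_bool e * (node w.1 w.2)^-1 |
  e in [set: bool] & w in dihedral `*` dihedral] (val t)].
exists T.
  apply/finite_val/finite_image2; first exact: finite_finset.
  by apply: finite_setX; exact: dihedral_finite.
move=> x; have [g [h [e [/rist_dihedral Gg /rist_dihedral Gh xE]]]] := node_sections (GrP x).
move: Gg Gh => [n [w [Nn Ww gE]]] [n' [w' [Nn' Ww' hE]]].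
have [Gy Gz] := (asboolT (rist_left Nn), asboolT Nn'.2).
pose y : grigorchuk := Sub (node n 1) Gy; pose z : grigorchuk := Sub (node 1 n') Gz.
(* The translation that removes the dihedral parts of both sections and the
   swap; written like this, it visibly belongs to the group. *)
exists (x^-1 * (y * z)), y, z; split; [|by exists n|by exists n'|by rewrite mulVKg].
exists e => //; exists (w, w') => //=; apply: (@mulgI _ (val x)).
have -> : val x * val (x^-1 * (y * z)) = node n 1 * node 1 n'.
  by rewrite -valM mulVKg.
rewrite xE gE hE -nodeM -!mulgA nodeM mul1g mulg1.
by case: e {xE} => /=; rewrite ?mul1g ?(mulgA a) ?mul_aa ?mul1g mulgV mulg1.
Qed.

End Grigorchuk.

(** * Infinite strong cop number *)

Theorem theorem1p4 :
  (forall G : groupType, finitely_generated G -> infinite_set [set: G] ->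
     forall (S : set (G * G)%type) (genS : generates S), finite_set S ->
       sCop (Cayley genS) = +oo%E)
  /\
  (forall (S : set grigorchuk) (genS : generates S), finite_set S ->
     sCop (Cayley genS) = +oo%E)
  /\
  (forall G : groupType, finitely_generated G -> branch_group G ->
     forall (S : set G) (genS : generates S), finite_set S ->
       sCop (Cayley genS) = +oo%E).
Proof.
split=> [G _ infG S genS finS|]; first exact: sCop_square.
split=> [S genS finS|G _ /branch_virtual_product[A [B [AB infA infB]]] S genS finS].
  have [A [B [AB infA infB]]] := grigorchuk_virtual_product.
  exact: (sCop_virtual_product genS finS AB infA infB).
exact: (sCop_virtual_product genS finS AB infA infB).
Qed.
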